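(* Let $\mathcal{L}_1=(S_1,\iota_1,\rightarrow_1)$ and $\mathcal{L}_2=(S_2,\iota_2,\rightarrow_2)$ be finite-state, finitely branching LTSs. Then the procedure $\textsc{Refines}_{\mathsf{fdr}}(\mathcal{L}_1,\mathcal{L}_2)$ terminates.
   Context: Fix a finite set $\mathit{Act}$ of actions not containing the internal action $\tau$; $\mathit{Act}_\tau=\mathit{Act}\cup\{\tau\}$. An LTS is $(S,\iota,\rightarrow)$ with $\iota\in S$ and $\rightarrow\subseteq S\times\mathit{Act}_\tau\times S$; $\mathsf{enabled}(s)=\{a\in\mathit{Act}_\tau\mid\exists t: s\xrightarrow{a}t\}$. The weak transition relation $\overset{\rho}{\Longrightarrow}$ ($\rho\in\mathit{Act}^*$) relates $s$ to $t$ iff there is a path from $s$ to $t$ whose labels, after deleting all $\tau$'s, form $\rho$. A state $s$ is stable if $\tau\notin\mathsf{enabled}(s)$; for stable $s$, $\mathsf{refusals}(s)=\mathcal{P}(\mathit{Act}\setminus\mathsf{enabled}(s))$; for a set $U$, $\mathsf{refusals}(U)=\{X\subseteq\mathit{Act}\mid\exists s\in U: s\text{ stable}\wedge X\in\mathsf{refusals}(s)\}$. A state diverges if it has an infinite sequence of $\tau$-transitions starting from it; a set diverges if one of its states does. On pairs $(U,s)\in\mathcal{P}(S_1)\times S_2$: $(U,s)\leq(V,t)$ iff $s=t$ and $U\subseteq V$; for a set $\mathcal{A}$ of pairs, $x\Subset\mathcal{A}$ iff some $y\in\mathcal{A}$ has $y\leq x$; $\mathcal{A}\Cup x=\{z\mid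 z=x\vee(z\in\mathcal{A}\wedge x\not\leq z)\}$. The procedure $\textsc{Refines}_{\mathsf{fdr}}$: let $I=(\{s\in S_1\mid\iota_1\overset{\epsilon}{\Longrightarrow}_1s\},\iota_2)$; initialise a stack $\mathit{working}$ containing only $I$ and $\mathit{antichain}:=\{I\}$. While $\mathit{working}$ is nonempty: pop $(\mathit{spec},\mathit{impl})$; if $\mathit{spec}$ does not diverge then: if $\mathit{impl}$ diverges return false; if $\mathit{impl}$ is stable and $\mathsf{refusals}(\mathit{impl})\not\subseteq\mathsf{refusals}(\mathit{spec})$ return false; for each transition $\mathit{impl}\xrightarrow{a}_2\mathit{impl}'$: let $\mathit{spec}'=\mathit{spec}$ if $a=\tau$, else $\mathit{spec}'=\{s'\mid\exists s\in\mathit{spec}: s\overset{a}{\Longrightarrow}_1s'\}$; if $\mathit{spec}'=\emptyset$ return false; if $(\mathit{spec}',\mathit{impl}')\not\Subset\mathit{antichain}$, set $\mathit{antichain}:=\mathit{antichain}\Cup(\mathit{spec}',\mathit{impl}')$ and push $(\mathit{spec}',\mathit{impl}')$ onto $\mathit{working}$. When $\mathit{working}$ is empty, return true. *)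

(* Defs.v *)
From mathcomp Require Import all_boot.
From mathcomp Require Import boolp classical_sets functions cardinality.

Set Implicit Arguments.
Unset Strict Implicit.
Unset Printing Implicit Defensive.

Local Open Scope classical_set_scope.

(* Labels are [option Act]: [None] is the internal action tau and [Some a] is
   the visible action [a]. *)
Record lts (Act : finType) := LTS {
  state : Type;
  init : state;
  trans : state -> option Act -> state -> Prop
}.

Section Lts.
Context {Act : finType}.
Variable L : lts Act.
Implicit Types (s t : state L) (U : set (state L)).

Definition finite_state : Prop := finite_set [set: state L].

Definition outgoing s : set (option Act * state L) :=
  [set p | trans s p.1 p.2].

Definition finitely_branching : Prop := forall s, finite_set (outgoing s).

Definition enabled s : set (option Act) := [set a | exists t, trans s a t].

Inductive lts_path : state L -> seq (option Act) -> state L -> Prop :=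
| lts_path_nil s : lts_path s [::] s
| lts_path_cons s a s' w t :
    trans s a s' -> lts_path s' w t -> lts_path s (a :: w) t.

(* [pmap id] drops the [None]s of a sequence of labels, i.e. deletes the taus *)
Definition weak_trans s (rho : seq Act) t : Prop :=
  exists2 w, lts_path s w t & pmap id w = rho.

Definition stable s : Prop := ~ enabled s None.

(* Only meaningful for stable [s]. *)
Definition refusals s : set (set Act) :=
  [set X | X `<=` ~` [set a | enabled s (Some a)]].

Definition set_refusals U : set (set Act) :=
  [set X | exists s, [/\ U s, stable s & refusals s X]].

Definition diverges s : Prop :=
  exists2 f : nat -> state L, f 0 = s & forall i, trans (f i) None (f i.+1).

Definition set_diverges U : Prop := exists2 s, U s & diverges s.

End Lts.

Section Antichain.
Variables S1 S2 : Type.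
Implicit Types (x y z : set S1 * S2) (A : set (set S1 * S2)).

Definition pair_le x y : Prop := x.2 = y.2 /\ x.1 `<=` y.1.

Definition covered x A : Prop := exists2 y, A y & pair_le y x.

Definition antichain_add A x : set (set S1 * S2) :=
  [set z | z = x \/ (A z /\ ~ pair_le x z)].

End Antichain.

Section Refines.
Context {Act : finType}.
Variables L1 L2 : lts Act.

Let node : Type := set (state L1) * state L2.

Definition spec_after (spec : set (state L1)) (a : option Act) :
    set (state L1) :=
  if a is Some b then [set s' | exists2 s, spec s & weak_trans s [:: b] s']
  else spec.

(* Control points of the procedure, with the values of its variables:
   the test of the while loop; the foreach loop over the outgoing transitions
   of [impl], where [todo] holds the transitions not yet visited; and the
   return of a Boolean. The head of [working] is the top of the stack. *)
Inductive config : Type :=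
| While (working : seq node) (antichain : set node)
| Foreach (spec : set (state L1)) (impl : state L2)
    (todo : set (option Act * state L2))
    (working : seq node) (antichain : set node)
| Return (b : bool).

Definition refines_fdr_start : config :=
  let I := ([set s | weak_trans (init L1) [::] s], init L2) in
  While [:: I] [set I].

Definition refusal_failure (spec : set (state L1)) (impl : state L2) : Prop :=
  stable impl /\ ~ (refusals impl `<=` set_refusals spec).

(* The procedure leaves the order in which transitions are visited open: the
   step relation allows any element of [todo] to be visited next. *)
Inductive refines_fdr_step : config -> config -> Prop :=
| step_empty antichain :
    refines_fdr_step (While [::] antichain) (Return true)
| step_spec_diverges spec impl working antichain :
    set_diverges spec ->
    refines_fdr_step (While ((spec, impl) :: working) antichain)
                     (While working antichain)
| step_impl_diverges spec impl working antichain :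
    ~ set_diverges spec -> diverges impl ->
    refines_fdr_step (While ((spec, impl) :: working) antichain)
                     (Return false)
| step_refusals spec impl working antichain :
    ~ set_diverges spec -> ~ diverges impl -> refusal_failure spec impl ->
    refines_fdr_step (While ((spec, impl) :: working) antichain)
                     (Return false)
| step_foreach spec impl working antichain :
    ~ set_diverges spec -> ~ diverges impl -> ~ refusal_failure spec impl ->
    refines_fdr_step (While ((spec, impl) :: working) antichain)
                     (Foreach spec impl (outgoing impl) working antichain)
| step_foreach_end spec impl working antichain :
    refines_fdr_step (Foreach spec impl set0 working antichain)
                     (While working antichain)
| step_no_spec spec impl todo working antichain a impl' :
    todo (a, impl') -> spec_after spec a = set0 ->
    refines_fdr_step (Foreach spec impl todo working antichain)
                     (Return false)
| step_covered spec impl todo working antichain a impl' :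
    todo (a, impl') -> spec_after spec a <> set0 ->
    covered (spec_after spec a, impl') antichain ->
    refines_fdr_step (Foreach spec impl todo working antichain)
                     (Foreach spec impl (todo `\ (a, impl'))
                        working antichain)
| step_push spec impl todo working antichain a impl' :
    todo (a, impl') -> spec_after spec a <> set0 ->
    ~ covered (spec_after spec a, impl') antichain ->
    refines_fdr_step (Foreach spec impl todo working antichain)
                     (Foreach spec impl (todo `\ (a, impl'))
                        ((spec_after spec a, impl') :: working)
                        (antichain_add antichain
                           (spec_after spec a, impl'))).

(* Every maximal execution is finite and ends in [Return]: running forever and
   getting stuck anywhere else are both excluded. *)
Inductive terminates_from : config -> Prop :=
| terminates_return b : terminates_from (Return b)
| terminates_step c :
    (exists c', refines_fdr_step c c') ->
    (forall c', refines_fdr_step c c' -> terminates_from c') ->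
    terminates_from c.

Definition refines_fdr_terminates : Prop := terminates_from refines_fdr_start.

End Refines.

(* Main.v *)
Require Import Defs.
From mathcomp Require Import all_boot.
From mathcomp Require Import boolp classical_sets functions cardinality finmap.

(* A pair is pushed only when it is not covered by the antichain. Removing the
   elements above the new pair uncovers nothing, so every push strictly shrinks
   the set of uncovered pairs, which is finite. Between pushes, every iteration
   of the while loop pops the stack and the foreach loop visits only the finitely
   many transitions of the popped implementation state. *)

Set Implicit Arguments.
Unset Strict Implicit.
Unset Printing Implicit Defensive.

Local Open Scope classical_set_scope.

(** Strict inclusion is well founded on finite sets: [fset_set] carries it to strict inclusion of
    finite sets in the sense of [{fset cT}], where strong induction is at hand. The type
    [{classic T}] supplies the choice structure that [T] lacks. *)
Lemma finite_set_proper_ind (T : Type) (P : set T -> Prop) :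
  (forall A, finite_set A -> (forall B, B `<` A -> P B) -> P A) ->
  forall A, finite_set A -> P A.
Proof.
move=> IH A finA; pose cT : choiceType := {classic T}.
move eX : (fset_set (A : set cT)) => X.
elim/finSet_rect: X => X IHX in A finA eX *.
apply: IH => // B [sBA nAB].
have finB : finite_set B := sub_finite_set sBA finA.
apply: (IHX (fset_set (B : set cT))) => //.
rewrite fproperE -eX; apply/andP; split; last apply/negP.
  all: by rewrite -fset_set_sub.
Qed.

Lemma finite_setT_set (T : Type) :
  finite_set [set: T] -> finite_set [set: set T].
Proof.
move=> finT; pose cT : choiceType := {classic T}.
pose F : {fset cT} := fset_set [set: cT].
(* Every subset of [T] is the image of a member of the finite powerset of [F]. *)
apply: (@sub_finite_set _ _
  ((fun X : {fset cT} => [set` X] : set T) @` [set` fpowerset F])); last first.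
  exact/finite_image/finite_fset.
move=> A _; have finA : finite_set A by apply: sub_finite_set finT.
exists (fset_set (A : set cT)); last exact: (fset_setK (finA : finite_set (A : set cT))).
by rewrite /= fpowersetE -fset_set_sub.
Qed.

Section Uncovered.
Variables S1 S2 : Type.
Implicit Types (x y : set S1 * S2) (A : set (set S1 * S2)).

Definition uncovered A : set (set S1 * S2) := [set x | ~ covered x A].

Lemma finite_uncovered A :
  finite_set [set: S1] -> finite_set [set: S2] -> finite_set (uncovered A).
Proof.
move=> fin1 fin2; apply: (@sub_finite_set _ _ ([set: set S1] `*` [set: S2])) => //.
by apply: finite_setX => //; apply: finite_setT_set.
Qed.

Lemma pair_le_refl x : pair_le x x.
Proof. by split. Qed.

Lemma pair_le_trans y x z : pair_le x y -> pair_le y z -> pair_le x z.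
Proof.
move=> [xy sxy] [yz syz]; split; first exact: etrans yz.
exact: subset_trans syz.
Qed.

(** If the element [z] covering [y] is discarded, then it lies above [x], and [x] covers [y] by
    transitivity. *)
Lemma covered_add A x y : covered y A -> covered y (antichain_add A x).
Proof.
move=> [z Az zy]; have [xz|xz] := EM (pair_le x z).
  by exists x; [left | apply: pair_le_trans zy].
by exists z => //; right.
Qed.

(** The inclusion is strict because [x] itself becomes covered. *)
Lemma uncovered_add A x :
  ~ covered x A -> uncovered (antichain_add A x) `<` uncovered A.
Proof.
move=> ncx; split=> [y ncy cy|sub]; first exact/ncy/covered_add.
by apply: (sub x ncx); exists x; [left | apply: pair_le_refl].
Qed.

End Uncovered.

Section Termination.
Context {Act : finType}.
Variables L1 L2 : lts Act.
Implicit Types (working : seq (set (state L1) * state L2))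
  (antichain : set (set (state L1) * state L2)).

Lemma refines_fdr_step_while working antichain :
  exists c, refines_fdr_step (While working antichain) c.
Proof.
case: working => [|[spec impl] working]; first by eexists; apply: step_empty.
have [?|?] := EM (set_diverges spec); first by eexists; apply: step_spec_diverges.
have [?|?] := EM (diverges impl); first by eexists; apply: step_impl_diverges.
have [?|?] := EM (refusal_failure spec impl).
  by eexists; apply: step_refusals.
by eexists; apply: step_foreach.
Qed.

Lemma refines_fdr_step_foreach spec impl todo working antichain :
  exists c, refines_fdr_step (Foreach (L1 := L1) (L2 := L2)
    spec impl todo working antichain) c.
Proof.
have [->|/set0P[[a impl'] todo_a]] := eqVneq todo set0.
  by eexists; apply: step_foreach_end.
have [?|?] := EM (spec_after spec a = set0).
  by eexists; apply: step_no_spec todo_a _.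
have [?|?] := EM (covered (spec_after spec a, impl') antichain).
  by eexists; apply: step_covered todo_a _ _.
by eexists; apply: step_push todo_a _ _.
Qed.

Lemma terminates_from_foreach working antichain :
  terminates_from (While working antichain) ->
  (forall antichain' working',
     uncovered antichain' `<` uncovered antichain ->
     forall spec impl todo, finite_set todo ->
     terminates_from (Foreach (L1 := L1) (L2 := L2)
       spec impl todo working' antichain')) ->
  forall spec impl todo, finite_set todo ->
  terminates_from (Foreach (L1 := L1) (L2 := L2)
    spec impl todo working antichain).
Proof.
move=> end_ok push_ok spec impl todo.
elim/finite_set_proper_ind => {}todo fin_todo IH.
apply: terminates_step => [|c' step]; first exact: refines_fdr_step_foreach.
inversion step; subst => //; try exact: terminates_return.
- apply: IH; split; first exact: subDsetl.
  by move=> /(_ (a, impl')) [] // _; apply.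
- apply: push_ok; first exact: uncovered_add.
  exact: finite_setD.
Qed.

Lemma terminates_from_while working antichain :
  finitely_branching L2 ->
  (forall working', size working' < size working ->
     terminates_from (While working' antichain) /\
     forall spec impl todo, finite_set todo ->
     terminates_from (Foreach (L1 := L1) (L2 := L2)
       spec impl todo working' antichain)) ->
  terminates_from (While working antichain).
Proof.
move=> branching2 pop_ok.
apply: terminates_step => [|c' step]; first exact: refines_fdr_step_while.
inversion step; subst; try exact: terminates_return.
- by have [] := pop_ok _ (ltnSn _).
- by have [_] := pop_ok _ (ltnSn _); apply; apply: branching2.
Qed.

(** Lexicographic induction: first on the set of uncovered pairs, then on the height of the stack.
    Both control points are treated together, since each loop leads into the other. *)
Lemma terminates_from_all antichain working :
  finite_state L1 -> finite_state L2 -> finitely_branching L2 ->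
  terminates_from (While working antichain) /\
  forall spec impl todo, finite_set todo ->
  terminates_from (Foreach (L1 := L1) (L2 := L2)
    spec impl todo working antichain).
Proof.
move=> finite1 finite2 branching2.
move eU : (uncovered antichain) => U.
have finU : finite_set U by rewrite -eU; apply: finite_uncovered.
(* The stack stays general here, so that it may grow whenever [U] shrinks. *)
elim/finite_set_proper_ind: finU => {}U _ IHU in antichain working eU *.
have [n le_n] := ubnP (size working).
elim: n => // n IHn in working le_n *.
have while_ok : terminates_from (While working antichain).
  apply: terminates_from_while => // working' lt_w.
  by apply: IHn; apply: leq_trans lt_w _.
split=> //; apply: terminates_from_foreach => // antichain' working'.
by rewrite eU => ltU; have [] := IHU _ ltU antichain' working' erefl.
Qed.

End Termination.

Theorem theorem5p6 (Act : finType) (L1 L2 : lts Act)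
    (finite1 : finite_state L1) (branching1 : finitely_branching L1)
    (finite2 : finite_state L2) (branching2 : finitely_branching L2) :
  refines_fdr_terminates L1 L2.
Proof.
exact: (terminates_from_all _ _ finite1 finite2 branching2).1.
Qed.
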